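(* Let $\mathcal{A}\subset\mathbb{Z}$ be a finite alphabet, let $G=(V,E)$ be a finite directed graph with edge labelling $\ell:E\to\mathcal{A}$ with $M=\sum_{a\in\mathcal{A}}M_a$ primitive, let $\beta$ be a Pisot number of degree $r$, and let $\nu$, $\mu$, $\Phi$ be as in the context. Let $z=m_0+m_1\beta+\cdots+m_{r-1}\beta^{r-1}\in\mathbb{Z}[\beta]$ with $m_0,\ldots,m_{r-1}\in\mathbb{Z}$. Then the limit $\lim_{k\to\infty}\widehat{\nu}(z\beta^k)$ exists, and it equals the Fourier coefficient $$\widehat{\psi}(m_0,\ldots,m_{r-1})=\int_{\mathbb{T}^r}e^{-2\pi i(m_0t_0+\cdots+m_{r-1}t_{r-1})}\,d\psi(t_0,\ldots,t_{r-1})$$ of the measure $\psi=\Phi_*(\mu)$ on $\mathbb{T}^r$.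
   Context: For $a\in\mathcal{A}$, $M_a$ is the $V\times V$ matrix with $(M_a)_{ij}=1$ if $(i,j)\in E$ and $\ell((i,j))=a$, and $0$ otherwise. By Perron–Frobenius, $M$ has a dominant eigenvalue $\lambda>0$ with positive left eigenvector $\mathbf v_L$ and right eigenvector $\mathbf v_R$, normalised by $\mathbf v_L^{\mathsf T}\mathbf v_R=1$. A path is a sequence of edges with the terminal vertex of each edge equal to the initial vertex of the next. $\mathcal{K}^+\subseteq\mathcal{A}^{\mathbb{N}}$ is the set of sequences $(\ell(e_k))_{k\ge1}$ for infinite paths in $G$, and $\mu^+$ the Borel probability measure on it with $\mu^+(\{x:x_1=\varepsilon_1,\ldots,x_k=\varepsilon_k\})=\lambda^{-k}\mathbf v_L^{\mathsf T}M_{\varepsilon_1}\cdots M_{\varepsilon_k}\mathbf v_R$. $\mathcal{K}\subseteq\mathcal{A}^{\mathbb{Z}}$ is the set of sequences $(\ell(e_k))_{k\in\mathbb{Z}}$ for bi-infinite paths $(e_k)_{k\in\mathbb{Z}}$ in $G$, and $\mu$ the Borel probability measure on $\mathcal{K}$ with $\mu(\{x: x_{m+1}=\varepsilon_1,\ldots,x_{m+k}=\varepsilon_k\})=\lambda^{-k}\mathbf v_L^{\mathsf T}M_{\varepsilon_1}\cdots M_{\varepsilon_k}\mathbf v_R$ for all $m\in\mathbb{Z}$. A Pisot number is an algebraic integer $>1$ all of whose other Galois conjugates have modulus $<1$ (integers $\ge2$ included). $\phi^+((x_k)_{k\ge1})=\sum_{k\ge1}x_k\beta^{-k}$, $\nu=(\phi^+)_*(\mu^+)$,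 and $\widehat{\nu}(t)=\int e^{-2\pi i x t}\,d\nu(x)$. With $\mathbb{T}=\mathbb{R}/\mathbb{Z}$, $\Phi:\mathcal{K}\to\mathbb{T}^r$ is $\Phi((x_k)_{k\in\mathbb{Z}})=\big(\sum_{k\in\mathbb{Z}}x_k\beta^{-k+m}\bmod 1\big)_{m=0}^{r-1}$, where the part of the series with $k\le0$ converges modulo $1$ because $\beta$ is Pisot (it is understood as $\lim_{n\to\infty}\sum_{k=-n}^\infty x_k\beta^{-k+m}\bmod 1$). *)

(* Defs.v *)
From HB Require Import structures.
From mathcomp Require Import all_boot all_order all_algebra.
From mathcomp Require Import all_classical all_reals all_analysis.
From mathcomp Require Import complex.
Set Implicit Arguments.
Unset Strict Implicit.
Unset Printing Implicit Defensive.
Import Order.TTheory GRing.Theory Num.Theory.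
Import numFieldNormedType.Exports.
Local Open Scope classical_set_scope.
Local Open Scope ring_scope.

(* One-sided sequences (x_k)_{k>=1} in Z^N are encoded as x : nat -> int *)
(* with  x_k = x (k-1).  Bi-infinite sequences are x : int -> int.       *)
Definition seqN := (nat -> int)%type.
HB.instance Definition _ := gen_eqMixin seqN.
HB.instance Definition _ := gen_choiceMixin seqN.
HB.instance Definition _ := isPointed.Build seqN (fun _ => 0).

Definition seqZ := (int -> int)%type.
HB.instance Definition _ := gen_eqMixin seqZ.
HB.instance Definition _ := gen_choiceMixin seqZ.
HB.instance Definition _ := isPointed.Build seqZ (fun _ => 0).

(* cylinder {x : x_1 = e_1, ..., x_k = e_k}  (one-sided, shifted indexing) *)
Definition cylN (w : seq int) : set seqN :=
  [set x | forall i : nat, (i < size w)%N -> x i = nth 0 w i].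

Definition cylZ (m : int) (w : seq int) : set seqZ :=
  [set x | forall i : nat, (i < size w)%N -> x (m + (i.+1)%:Z) = nth 0 w i].

Definition cylindersN : set (set seqN) := [set C | exists w, C = cylN w].
Definition cylindersZ : set (set seqZ) := [set C | exists m w, C = cylZ m w].

Definition SeqN := g_sigma_algebraType cylindersN.
Definition SeqZ := g_sigma_algebraType cylindersZ.

(* The torus T^r, points represented by their representatives in       *)
(* [0,1)^r; sigma-algebra generated by boxes of Borel sets.             *)
Definition torus_carrier (R : realType) (r : nat) := ('I_r -> R)%type.
HB.instance Definition _ (R : realType) (r : nat) :=
  gen_eqMixin (torus_carrier R r).
HB.instance Definition _ (R : realType) (r : nat) :=
  gen_choiceMixin (torus_carrier R r).
HB.instance Definition _ (R : realType) (r : nat) :=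
  isPointed.Build (torus_carrier R r) (fun _ => 0).

Definition torus_boxes (R : realType) (r : nat) : set (set (torus_carrier R r)) :=
  [set C | exists B : 'I_r -> set R,
      (forall i, measurable (B i)) /\ C = [set t | forall i, B i (t i)]].

Definition Torus (R : realType) (r : nat) := g_sigma_algebraType (@torus_boxes R r).

Section Defs.
Variable R : realType.

Definition label_mx (n : nat) (E : rel 'I_n.+1) (l : 'I_n.+1 -> 'I_n.+1 -> int)
  (a : int) : 'M[R]_n.+1 :=
  \matrix_(i, j) ((E i j && (l i j == a))%:R).

Definition total_mx (n : nat) (A : seq int) (E : rel 'I_n.+1)
  (l : 'I_n.+1 -> 'I_n.+1 -> int) : 'M[R]_n.+1 :=
  \sum_(a <- A) label_mx E l a.

Definition primitive_mx (n : nat) (M : 'M[R]_n.+1) : Prop :=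
  (forall i j, 0 <= M i j) /\ exists k : nat, forall i j, 0 < (M ^+ k) i j.

Definition cyl_weight (n : nat) (E : rel 'I_n.+1) (l : 'I_n.+1 -> 'I_n.+1 -> int)
  (lam : R) (vL vR : 'cV[R]_n.+1) (w : seq int) : R :=
  lam ^- size w * ((vL^T *m (\prod_(e <- w) label_mx E l e) *m vR) ord0 ord0).

Definition pisot (beta : R) (r : nat) : Prop :=
  1 < beta /\
  exists p : {poly int},
    [/\ p \is monic,
        irreducible_poly (map_poly (intr : int -> rat) p),
        size p = r.+1,
        root (map_poly (intr : int -> R) p) beta &
        forall z : R[i], root (map_poly (intr : int -> R[i]) p) z ->
                         z != (beta%:C)%C -> `|z| < 1].

Definition phiplus (beta : R) (x : SeqN) : R :=
  limn (fun N => \sum_(k < N) (x k)%:~R * beta ^- k.+1).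

(* Fourier transform of a (finite Borel) measure on R:
   nu^(t) = int e^{-2 pi i x t} dnu(x) = re + i im *)
Definition ft_re (nu : set R -> \bar R) (t : R) : R :=
  fine (\int[nu]_x (cos (2 * pi * x * t))%:E)%E.
Definition ft_im (nu : set R -> \bar R) (t : R) : R :=
  - fine (\int[nu]_x (sin (2 * pi * x * t))%:E)%E.

Definition frac (y : R) : R := y - (Num.floor y)%:~R.
Definition tdist (a b : R) : R := Num.min (frac (a - b)) (1 - frac (a - b)).

(* sum_{k = -n}^{oo} x_k beta^{-k+m} (index k = j - n) *)
Definition Phi_partial (beta : R) (m : nat) (x : SeqZ) (n : nat) : R :=
  limn (fun N => \sum_(j < N)
        (x (j%:Z - n%:Z))%:~R * beta ^ (m%:Z + n%:Z - j%:Z)).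

(* Phi_m(x) = lim_n (Phi_partial n) mod 1, as representative in [0,1) *)
Definition Phi (beta : R) (r : nat) (x : SeqZ) : Torus R r :=
  fun i : 'I_r => xget 0 [set t : R | (0 <= t < 1) /\
     (fun n => tdist (Phi_partial beta i x n) t) @ \oo --> (0 : R)].

Definition fc_re (r : nat) (psi : set (Torus R r) -> \bar R) (m : 'I_r -> int) : R :=
  fine (\int[psi]_t (cos (2 * pi * \sum_(j < r) (m j)%:~R * t j))%:E)%E.
Definition fc_im (r : nat) (psi : set (Torus R r) -> \bar R) (m : 'I_r -> int) : R :=
  - fine (\int[psi]_t (sin (2 * pi * \sum_(j < r) (m j)%:~R * t j))%:E)%E.

End Defs.
Arguments Phi {R} beta r x.

(* Main.v *)
(** By stationarity, the image of [mu] under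
    [y |-> (y_{k-n})_{k>=1}] is [mu_plus] for every [n], so that
    [nu^(z beta^n)] is the integral against [mu] of [e(- w_n)] with
    [w_n = sum_{k > -n} y_k z beta^(-k)]. Expanding [z] in powers of [beta],
    [w_n] is the combination with coefficients [m_j] of the partial sums
    defining the coordinates of [Phi]. Each of these converges modulo 1, because
    [beta^k] differs from an integer, the sum of the [k]-th powers of the
    conjugates of [beta], by a summable amount. The dominated convergence
    theorem concludes. *)
Require Import Defs.
From HB Require Import structures.
From mathcomp Require Import all_boot all_order all_algebra.
From mathcomp Require Import all_classical all_reals all_analysis.
From mathcomp Require Import complex separable ring lra measurable_realfun.
Set Implicit Arguments.
Unset Strict Implicit.
Unset Printing Implicit Defensive.
Import Order.TTheory GRing.Theory Num.Theory.
Import numFieldNormedType.Exports.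
(* [fraction] also defines a [frac]. *)
Import Defs.
Local Open Scope classical_set_scope.
Local Open Scope ring_scope.

(** * Measurability of limits *)

Section LimMeasurable.
Context d (T : measurableType d) (R : realType).

(** Upper and lower limits in the extended reals always exist and depend measurably on a parameter,
    so this criterion makes the set of convergence points measurable. *)
Lemma EFin_cvgn (u : R ^nat) : cvgn u <->
  limn_esup (EFin \o u) \is a fin_num /\
  limn_einf (EFin \o u) = limn_esup (EFin \o u).
Proof.
split=> [/cvg_ex[l ul]|[ufin uE]].
  have /cvg_limn_einf_sup[-> ->] : EFin \o u @ \oo --> l%:E.
    by apply/cvg_EFin => //; exact: nearW.
  by [].
apply/cvg_ex; exists (fine (limn_esup (EFin \o u))).
have : EFin \o u @ \oo --> (fine (limn_esup (EFin \o u)))%:E.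
  rewrite fineK//.
  apply: (@squeeze_cvge _ _ _ _ (einfs (EFin \o u)) _ (esups (EFin \o u))).
  - apply: nearW => n; apply/andP; split.
      by apply: ereal_inf_lbound; exists n => /=.
    by apply: ereal_sup_ubound; exists n => /=.
  - by rewrite -uE limn_einf_lim; exact: is_cvg_einfs.
  - by rewrite limn_esup_lim; exact: is_cvg_esups.
by move/fine_cvg.
Qed.

Variable f : (T -> R)^nat.
Hypothesis mf : forall n, measurable_fun setT (f n).

Let mEf n : measurable_fun setT (fun x => (f n x)%:E).
Proof. exact/measurable_EFinP. Qed.

Let msup : measurable_fun setT (fun x => limn_esup (EFin \o f ^~ x)).
Proof. exact: (measurable_fun_limn_esup mEf). Qed.

Let minf : measurable_fun setT (fun x => limn_einf (EFin \o f ^~ x)).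
Proof.
rewrite /limn_einf; apply: measurableT_comp => //.
apply: (@measurable_fun_limn_esup _ _ _ _ (fun n x => - (f n x)%:E)%E) => n.
by apply: measurableT_comp.
Qed.

Lemma measurable_fun_asbool_cvgn :
  measurable_fun setT (fun x => `[< cvgn (f ^~ x) >]).
Proof.
rewrite (_ : (fun _ => _) = (fun x => (limn_esup (EFin \o f ^~ x) \is a fin_num) &&
   (limn_einf (EFin \o f ^~ x) == limn_esup (EFin \o f ^~ x)))); last first.
  apply/funext => x; apply/asboolP/idP => [/EFin_cvgn[-> ->]|/andP[? /eqP ?]].
    by rewrite eqxx.
  exact/EFin_cvgn.
apply: measurable_and; last exact: measurable_fun_eqe.
(* Finiteness is rewritten as an equality of two extended-real functions, a form to which
   [measurable_fun_eqe] applies. *)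
rewrite (_ : (fun _ => _) = (fun x =>
    (fine (limn_esup (EFin \o f ^~ x)))%:E == limn_esup (EFin \o f ^~ x))); last first.
  apply/funext => x; apply/idP/eqP => [/fineK//|<-].
  by rewrite fin_numE.
apply: measurable_fun_eqe => //; apply/measurable_EFinP.
exact: measurableT_comp.
Qed.

(** No convergence is assumed: [limn] takes the value [point] on divergent sequences, so the limit
    is glued from two measurable functions along the convergence set. *)
Lemma measurable_fun_limn : measurable_fun setT (fun x => limn (f ^~ x)).
Proof.
rewrite (_ : (fun _ => _) = (fun x => if `[< cvgn (f ^~ x) >]
    then fine (limn_esup (EFin \o f ^~ x)) else point)); last first.
  apply/funext => x; case: asboolP => [/cvg_ex[l ul]|/dvgP//].
  have /cvg_limn_einf_sup[_ ->] : EFin \o f ^~ x @ \oo --> l%:E.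
    by apply/cvg_EFin => //; exact: nearW.
  exact/cvg_lim.
apply: measurable_fun_ifT => //; first exact: measurable_fun_asbool_cvgn.
exact: measurableT_comp.
Qed.

End LimMeasurable.

(** * Limits modulo 1 *)

Section Circle.
Context (R : realType).
Implicit Types (a b t q : R) (y : R^nat).

Lemma frac_itv a : 0 <= frac a < 1.
Proof.
have /andP[] := floor_itv a; rewrite rmorphD /= => f0 f1.
by rewrite /frac; apply/andP; split; lra.
Qed.

Lemma frac_id a : 0 <= a < 1 -> frac a = a.
Proof. by move=> a01; rewrite /frac (@floor_def _ a 0) ?subr0. Qed.

Lemma frac_addz a (m : int) : frac (a + m%:~R) = frac a.
Proof. by rewrite /frac floorDrz ?intr_int// intrKfloor rmorphD /=; ring. Qed.

(** [tdist a b] is the distance from [a - b] to the nearest integer; the cases are [m] at most the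
    floor of [a - b] and [m] at least one above it. *)
Lemma tdist_le a b (m : int) : tdist a b <= `|a - b - m%:~R|.
Proof.
rewrite /tdist; have := frac_itv (a - b); rewrite {1 2}/frac.
set f := a - b - _ => /andP[f0 f1].
have fE : frac (a - b) = f by [].
have -> : a - b - m%:~R = f + (Num.floor (a - b) - m)%:~R.
  by rewrite rmorphB /= /f; ring.
rewrite fE; have [m0|m0] := leP 0 (Num.floor (a - b) - m).
  have : 0 <= (Num.floor (a - b) - m)%:~R :> R by rewrite ler0z.
  by move=> m0'; rewrite ge_min ger0_norm; [apply/orP; left|]; lra.
have : (Num.floor (a - b) - m)%:~R <= -1 :> R.
  by rewrite -(rmorphN1 (intr : int -> R)) /= ler_int -ltzD1 addNr.
by move=> m0'; rewrite ge_min ler0_norm; [apply/orP; right|]; lra.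
Qed.

Lemma tdist_ex a b : exists m : int, tdist a b = `|a - b - m%:~R|.
Proof.
have /andP[f0 f1] := frac_itv (a - b).
rewrite /tdist; case: (leP (frac (a - b))) => _.
  by exists (Num.floor (a - b)); rewrite ger0_norm.
exists (Num.floor (a - b) + 1); rewrite rmorphD rmorph1 /= opprD addrA -/(frac (a - b)).
rewrite ler0_norm; first by rewrite opprB /frac; ring.
by move: f1; rewrite /frac; lra.
Qed.

Definition tcvg y t := (fun n => tdist (y n) t) @ \oo --> (0 : R).

(** Subtracting nearest integers turns convergence modulo 1 into ordinary convergence, to which the
    usual rules for limits apply. *)
Lemma tcvgP y t : tcvg y t <->
  exists m : nat -> int, (fun n => y n - (m n)%:~R) @ \oo --> t.
Proof.
split=> [yt|[m ymt]].
  have [m mE] := choice (fun n => tdist_ex (y n) t).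
  exists m; apply/subr_cvg0/norm_cvg0P.
  by apply: cvg_trans yt; apply: near_eq_cvg; apply: nearW => n /=; rewrite mE addrAC.
apply: (@squeeze_cvgr _ _ _ _ (cst 0) (fun n => `|y n - (m n)%:~R - t|)).
- apply: nearW => n /=; rewrite -addrAC tdist_le andbT.
  by have [k ->] := tdist_ex (y n) t.
- exact: cvg_cst.
- exact/norm_cvg0P/subr_cvg0.
Qed.

Lemma tcvg_unique y t t' :
  0 <= t < 1 -> 0 <= t' < 1 -> tcvg y t -> tcvg y t' -> t = t'.
Proof.
move=> t01 t'01 /tcvgP[m yt] /tcvgP[m' yt'].
apply: contrapT => /eqP tt'.
have tt'1 : `|t - t'| < 1.
  by rewrite ltr_norml; apply/andP; split; lra.
have tt'0 : 0 < `|t - t'| by rewrite normr_gt0 subr_eq0.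
(* An integer within [e] of [t - t'] is nonzero by the first bound and of modulus less than 1 by the
   second, which is absurd. *)
pose e := Num.min `|t - t'| (1 - `|t - t'|).
have e0 : 0 < e by rewrite /e lt_min tt'0 /= subr_gt0.
have ytt' : (fun n => (m' n - m n)%:~R : R) @ \oo --> t - t'.
  rewrite (_ : (fun n => _) = (fun n => y n - (m n)%:~R - (y n - (m' n)%:~R))).
    exact: cvgB.
  by apply/funext => n; rewrite rmorphB /=; ring.
move/cvgrPdist_lt : ytt' => /(_ _ e0)[N _ /(_ N (leqnn N))/=].
rewrite lt_min => /andP[h1 h2].
have : `|(m' N - m N)%:~R : R| < 1.
  rewrite -[X in `|X|](subKr (t - t')); apply: (le_lt_trans (ler_normB _ _)).
  by rewrite -ltrBrDl.
rewrite -intr_norm ltrz1 => m0.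
have {}m0 : m' N - m N = 0 by apply/eqP; rewrite -normr_le0 -ltzD1.
by move: h1; rewrite m0 subr0 ltxx.
Qed.

Lemma cvg_frac_tcvg y q l :
  (fun n => frac (y n - q)) @ \oo --> l -> tcvg y (frac (l + q)).
Proof.
move=> yl; apply/tcvgP.
exists (fun n => Num.floor (y n - q) + Num.floor (l + q)).
have -> : (fun n => y n - (Num.floor (y n - q) + Num.floor (l + q))%:~R) =
    (fun n => frac (y n - q) + (q - (Num.floor (l + q))%:~R)).
  by apply/funext => n; rewrite /frac rmorphD /=; ring.
by rewrite [X in _ --> X]/frac -addrA; apply: cvgD => //; exact: cvg_cst.
Qed.

(** The strict inequalities keep the limit away from the jumps of [frac]: late terms, corrected by
    integers, stay inside the open unit interval, where [frac] is the identity. *)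
Lemma tcvg_cvg_frac y t q (m : int) : 0 < t - q - m%:~R < 1 ->
  tcvg y t -> (fun n => frac (y n - q)) @ \oo --> t - q - m%:~R.
Proof.
move=> /andP[t0 t1] /tcvgP[k ykt].
have ul : (fun n => y n - (k n)%:~R - q - m%:~R) @ \oo --> t - q - m%:~R.
  by apply: cvgB; [apply: cvgB => //|]; exact: cvg_cst.
have ugt := cvgr_gt _ ul _ t0; have ult := cvgr_lt _ ul _ t1.
apply: cvg_trans ul; apply: near_eq_cvg; near=> n.
have u0 : 0 < y n - (k n)%:~R - q - m%:~R by near: n; exact: ugt.
have u1 : y n - (k n)%:~R - q - m%:~R < 1 by near: n; exact: ult.
rewrite -[LHS]frac_id ?u1 ?ltW//.
by rewrite -(frac_addz (y n - q) (- k n - m)) rmorphB rmorphN /=; congr frac; ring.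
Unshelve. all: by end_near. Qed.

(* [Phi beta r x i] is by definition [tlim (Phi_partial beta i x)]. *)
Definition tlim y : R := xget 0 [set t | 0 <= t < 1 /\ tcvg y t].

Lemma tlimP y t : tcvg y t -> tcvg y (tlim y).
Proof.
move=> yt; rewrite /tlim; case: xgetP => [_ -> []//|/(_ (frac t))].
case; split; first exact: frac_itv.
move/tcvgP : yt => [m ymt]; apply/tcvgP; exists (fun n => m n + Num.floor t).
have -> : (fun n => y n - (m n + Num.floor t)%:~R) =
    (fun n => y n - (m n)%:~R - (Num.floor t)%:~R).
  by apply/funext => n; rewrite rmorphD /=; ring.
by apply: cvgB => //; exact: cvg_cst.
Qed.

Lemma tlim_eq y t : 0 <= t < 1 -> tcvg y t -> tlim y = t.
Proof.
move=> t01 yt; rewrite /tlim; case: xgetP => [_ -> [? ?]|/(_ t)]; last by case.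
exact: tcvg_unique yt.
Qed.

(* The circle is covered by two arcs on which [frac], recentred at [q], is
   continuous; this turns the limit modulo 1 into ordinary limits. *)
Lemma tlimE y : tlim y =
  if `[< cvgn (fun n => frac (y n - 0)) >] then
    frac (limn (fun n => frac (y n - 0)) + 0)
  else if `[< cvgn (fun n => frac (y n - 2^-1)) >] then
    frac (limn (fun n => frac (y n - 2^-1)) + 2^-1)
  else 0.
Proof.
case: asboolP => [/cvg_frac_tcvg|nc0]; first exact/tlim_eq/frac_itv.
case: asboolP => [/cvg_frac_tcvg|nc1]; first exact/tlim_eq/frac_itv.
(* Without a limit modulo 1, [xget] returns its default 0. Otherwise the arc recentred at 1/2
   handles [t = 0], as 0 - 1/2 + 1 = 1/2, and the arc recentred at 0 handles [t > 0]. *)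
rewrite /tlim; case: xgetP => // t _ [/andP[t0 t1] yt]; exfalso.
move: t0; rewrite le_eqVlt => /predU1P[t0|t0].
  apply: nc1; apply/cvg_ex; exists (t - 2^-1 - (-1)%:~R).
  by apply: tcvg_cvg_frac yt; rewrite -t0; lra.
by apply: nc0; apply/cvg_ex; exists (t - 0 - 0%:~R); apply: tcvg_cvg_frac yt; lra.
Qed.

Lemma measurable_frac : measurable_fun setT (@frac R).
Proof.
apply: (@measurable_funB _ _ _ _ id (fun a : R => (Num.floor a)%:~R)) => //.
have floor_homo : {homo (fun a : R => (Num.floor a)%:~R : R) : a b / a <= b}.
  by move=> a b ab; rewrite ler_int le_floor.
exact: nondecreasing_measurable.
Qed.

Lemma measurable_fun_tlim d (T : measurableType d) (f : (T -> R)^nat) :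
  (forall n, measurable_fun setT (f n)) ->
  measurable_fun setT (fun x => tlim (f ^~ x)).
Proof.
move=> mf; have mfrac q n : measurable_fun setT (fun x => frac (f n x - q)).
  apply: (measurableT_comp (g := fun x => f n x - q) measurable_frac).
  by apply: (@measurable_funB _ _ _ _ (f n) (cst q)) => //; exact: mf.
rewrite (funext (fun x => tlimE (f ^~ x))).
have mlim q : measurable_fun setT
    (fun x => frac (limn (fun n => frac (f n x - q)) + q)).
  apply: (measurableT_comp (g := fun x => limn (fun n => frac (f n x - q)) + q)
    measurable_frac).
  apply: (@measurable_funD _ _ _ _
    (fun x => limn (fun n => frac (f n x - q))) (cst q)) => //.
  exact: (measurable_fun_limn (mfrac q)).
apply: measurable_fun_ifT => //.
  exact: (measurable_fun_asbool_cvgn (mfrac 0)).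
apply: measurable_fun_ifT => //.
exact: (measurable_fun_asbool_cvgn (mfrac 2^-1)).
Qed.

End Circle.

(** * Measures on sequence spaces *)

Section SequenceSpaces.
Context (R : realType).

Lemma measurable_cylN w : measurable (cylN w : set SeqN).
Proof. by apply: sub_sigma_algebra; exists w. Qed.

Lemma measurable_cylZ m w : measurable (cylZ m w : set SeqZ).
Proof. by apply: sub_sigma_algebra; exists m, w. Qed.

(** The set is a union of cylinders over the words of length [i.+1] whose last letter lies in [B],
    and there are only countably many words. *)
Lemma measurable_letterN (B : set int) i : measurable [set x : SeqN | B (x i)].
Proof.
rewrite (_ : [set x | _] = \bigcup_(w in [set: seq int])
    (if `[< size w = i.+1 /\ B (nth 0 w i) >] then cylN w else set0)).
  apply: countable_bigcupT_measurable => // w; case: ifP => _ //.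
  exact: measurable_cylN.
apply/seteqP; split=> [x /= Bx|x [w _]].
  exists (mkseq x i.+1) => //; rewrite asboolT ?size_mkseq ?nth_mkseq//.
  by move=> j; rewrite size_mkseq => ji; rewrite nth_mkseq.
by case: asboolP => //= -[sw Bw] xw; rewrite xw// sw.
Qed.

Lemma measurable_letterZ (B : set int) i : measurable [set x : SeqZ | B (x i)].
Proof.
rewrite (_ : [set x | _] = \bigcup_(a in [set: int])
    (if `[< B a >] then cylZ (i - 1) [:: a] else set0)).
  apply: countable_bigcupT_measurable => // a; case: ifP => _ //.
  exact: measurable_cylZ.
apply/seteqP; split=> [x /= Bx|x [a _]].
  exists (x i) => //; case: asboolP => // _ [|//] _ /=.
  by rewrite subrK.
by case: asboolP => //= Ba /(_ 0 isT)/=; rewrite subrK => ->.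
Qed.

Lemma measurable_fun_letterN i :
  measurable_fun setT (fun x : SeqN => (x i)%:~R : R).
Proof.
move=> _ Y mY; rewrite setTI.
exact: (measurable_letterN [set a | Y a%:~R]).
Qed.

Lemma measurable_fun_letterZ i :
  measurable_fun setT (fun x : SeqZ => (x i)%:~R : R).
Proof.
move=> _ Y mY; rewrite setTI.
exact: (measurable_letterZ [set a | Y a%:~R]).
Qed.

(** The tail starts at the index [- n]. As [x i] encodes the letter of index [i.+1], even [tailN 0]
    is a shift by one; this is why [tailN n] is later paired with [beta ^+ n.+1]. *)
Definition tailN (n : nat) (y : SeqZ) : SeqN := fun i => y (i%:Z - n%:Z).

Lemma preimage_tailN n w : tailN n @^-1` cylN w = cylZ (- n%:Z - 1) w.
Proof.
by apply/seteqP; split=> y yw i iw; rewrite -(yw _ iw) /tailN; congr y;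
  rewrite -addn1 PoszD; ring.
Qed.

Lemma measurable_tailN n : measurable_fun setT (tailN n).
Proof.
apply: (@measurability _ _ SeqZ SeqN setT (tailN n) cylindersN) => // _ [_ [w ->] <-].
by rewrite setTI preimage_tailN; exact: measurable_cylZ.
Qed.

Lemma cylN_nil : cylN [::] = setT.
Proof. exact/seteqP. Qed.

Lemma cylN_cat_sub u v : cylN (u ++ v) `<=` cylN u.
Proof.
move=> x xuv i iu; rewrite xuv; first by rewrite nth_cat iu.
by rewrite size_cat ltn_addr.
Qed.

Lemma cylN_rcons u a : cylN (rcons u a) = cylN u `&` [set x | x (size u) = a].
Proof.
apply/seteqP; split=> [x xu|x [xu xa] i].
  split; first by apply: (@cylN_cat_sub u [:: a]); rewrite cats1.
  by rewrite /= xu ?size_rcons// nth_rcons ltnn eqxx.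
by rewrite size_rcons ltnS leq_eqVlt nth_rcons => /predU1P[->|iu];
  [rewrite ltnn eqxx|rewrite iu xu].
Qed.

(** Two cylinders are nested when one word is a prefix of the other, and disjoint otherwise; the
    empty set is added for the second case. *)
Lemma setI_closed_cylN : setI_closed [set C | C = set0 \/ cylindersN C].
Proof.
have cyl_meet u v : (size u <= size v)%N ->
    cylN u `&` cylN v = if take (size u) v == u then cylN v else set0.
  move=> uv; case: eqP => [uE|uE].
    by apply: setIidr; rewrite -[v in cylN v](cat_take_drop (size u)) uE;
      exact: cylN_cat_sub.
  apply/seteqP; split=> // x [xu xv]; apply: uE.
  apply: (@eq_from_nth _ 0); first by rewrite size_takel.
  rewrite size_takel// => i iu.
  by rewrite nth_take// -xu// -xv// (leq_trans iu).
move=> C D [->|[u ->]] [->|[v ->]]; rewrite ?set0I ?setI0; try by left.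
wlog uv : u v / (size u <= size v)%N.
  by move=> H; have [/H//|/ltnW/H] := leqP (size u) (size v); rewrite setIC.
by rewrite cyl_meet//; case: ifP => _; [right; exists v|left].
Qed.

Lemma sigma_algebra_cylN :
  @measurable _ SeqN = <<s [set C | C = set0 \/ cylindersN C] >>.
Proof.
apply/seteqP; split; first by apply: sub_sigma_algebra2 => C; right.
apply: smallest_sub; first exact: smallest_sigma_algebra.
by move=> _ [->|[w ->]]; [exact: measurable0|exact: measurable_cylN].
Qed.

Section Weights.
Variables (A : seq int) (wt : seq int -> R).
Hypothesis uniqA : uniq A.
Hypothesis wtS : forall w, all (mem A) w -> wt w = \sum_(a <- A) wt (rcons w a).

Section Null.
Variable P : {measure set SeqN -> \bar R}.
Hypothesis PA : forall w, all (mem A) w -> P (cylN w) = (wt w)%:E.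

Lemma measure_cylN_letters u s : all (mem A) u -> all (mem A) s -> uniq s ->
  P (cylN u `&` [set x | x (size u) \in s]) =
  (\sum_(a <- s) wt (rcons u a))%:E.
Proof.
move=> uA; elim: s => [_ _|a s IH /=/andP[aA sA] /andP[as_ us]].
  by rewrite big_nil (_ : _ `&` _ = set0) ?measure0//; apply/seteqP; split=> // x [].
rewrite big_cons EFinD -PA ?all_rcons ?uA ?andbT// -IH// -measureU.
- congr (P _); rewrite cylN_rcons -setIUr; congr (_ `&` _).
  apply/seteqP; split=> x /=; rewrite inE.
    by case/predU1P; [left|right].
  by case=> [->|->]; rewrite ?eqxx ?orbT.
- exact: measurable_cylN.
- apply: measurableI; first exact: measurable_cylN.
  exact: (measurable_letterN [set b | b \in s]).
- rewrite cylN_rcons; apply/seteqP; split=> // x [[_ /= ->] [_ /=]].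
  by rewrite (negbTE as_).
Qed.

(** By [wtS] the extensions of [u] by letters of [A] already exhaust the finite mass of [cylN u]. *)
Lemma measure_cylN_notin u : all (mem A) u ->
  P (cylN u `&` [set x | x (size u) \notin A]) = 0%E.
Proof.
move=> uA; have mA : measurable [set x : SeqN | x (size u) \in A].
  exact: (measurable_letterN [set b | b \in A]).
have : P (cylN u) = (P (cylN u `&` [set x | x (size u) \in A%SEQ]) +
    P (cylN u `&` [set x | x (size u) \notin A%SEQ]))%E.
  rewrite -measureU.
  - rewrite -setIUr (_ : _ `|` _ = setT) ?setIT//.
    by apply/seteqP; split=> // x _ /=; case: (x (size u) \in A); [left|right].
  - by apply: measurableI => //; exact: measurable_cylN.
  - apply: measurableI; first exact: measurable_cylN.
    exact: (measurable_letterN [set b | b \notin A]).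
  - by apply/seteqP; split=> // x [[_ /= h] [_ /=]]; rewrite h.
have AA : all (mem A) A by apply/allP.
rewrite measure_cylN_letters//.
rewrite PA// -wtS// => /eqP; rewrite addeC -sube_eq//=; last first.
  by rewrite fin_num_adde_defl.
by rewrite subee// eq_sym => /eqP.
Qed.

(** Cutting [w] at its first letter outside [A] places the cylinder inside a null set of the
    preceding lemma. *)
Lemma measure_cylN_eq0 w : ~~ all (mem A) w -> P (cylN w) = 0%E.
Proof.
move=> wA; have [u [b [v [-> uA bA]]]] : exists u b v,
    [/\ w = rcons u b ++ v, all (mem A) u & b \notin A].
  elim: w wA => //= a w IH; rewrite negb_and.
  have [aA /=|aA _] := boolP (a \in A); last by exists [::], a, w.
  by move/IH => [u [b [v [-> uA bA]]]]; exists (a :: u), b, v; split=> //=; rewrite aA.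
apply/eqP; rewrite -measure_le0 -(measure_cylN_notin uA).
apply: le_measure; rewrite ?inE; first exact: measurable_cylN.
  apply: measurableI; first exact: measurable_cylN.
  exact: (measurable_letterN [set b | b \notin A]).
apply: (subset_trans (@cylN_cat_sub _ _)); rewrite cylN_rcons.
by apply: setIS => x /= ->.
Qed.

Lemma ae_letters : {ae P, forall x, forall i, x i \in A}.
Proof.
rewrite /almost_everywhere.
(* The null cylinders are enumerated through the countability of words; codes of no word, or of a
   word over [A], contribute the empty set. *)
pose F n : set SeqN := if (unpickle n : option (seq int)) is Some w then
  if all (mem A) w then set0 else cylN w else set0.
apply: (@negligibleS _ _ _ _ (\bigcup_n F n)); last first.
  apply: negligible_bigcup => n; rewrite /F.
  case: unpickle => [w|]; last exact: negligible_set0.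
  case: ifPn => wA; first exact: negligible_set0.
  by apply/negligibleP; [exact: measurable_cylN|exact: measure_cylN_eq0].
move=> x /existsNP[i xi]; exists (pickle (mkseq x i.+1)) => //.
rewrite /F pickleK; case: ifPn => [/allP xA|_].
  exfalso; apply: xi; apply: xA; apply/mapP; exists i => //.
  by rewrite mem_iota/=.
by move=> j; rewrite size_mkseq => ji; rewrite nth_mkseq.
Qed.

End Null.

(** Cylinders form a generating class closed under intersection. The hypotheses only concern words
    over [A]; on the other words both measures vanish. *)
Lemma eq_measure_cylN (P Q : {measure set SeqN -> \bar R}) :
  (forall w, all (mem A) w -> P (cylN w) = (wt w)%:E) ->
  (forall w, all (mem A) w -> Q (cylN w) = (wt w)%:E) ->
  forall B, measurable B -> P B = Q B.
Proof.
move=> PA QA; apply: (measure_unique _ (fun=> setT) sigma_algebra_cylN).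
- exact: setI_closed_cylN.
- by move=> _; right; exists [::]; rewrite cylN_nil.
- exact: bigcup_const.
- move=> _ [->|[w ->]]; first by rewrite !measure0.
  have [wA|wA] := boolP (all (mem A) w); first by rewrite [LHS]PA// [RHS]QA.
  by rewrite [LHS](measure_cylN_eq0 PA wA) [RHS](measure_cylN_eq0 QA wA).
- by move=> _; rewrite -cylN_nil [X in (X < _)%E]PA// ltry.
Qed.

End Weights.
End SequenceSpaces.

(** * Powers of a Pisot number *)

Section PowerSums.
Variable F : comNzRingType.
Implicit Types (z : F) (rs : seq F).

(* [newton_quot rs k] is [sum_z z^k prod_(y != z) (X - y)]: it starts from the
   derivative of [prod_y (X - y)], and [newton_quotS] makes it and the power
   sums integral by a joint induction. *)
Fixpoint newton_quot rs k : {poly F} :=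
  if rs is z :: rs' then
    ('X - z%:P) * newton_quot rs' k + z ^+ k *: \prod_(y <- rs') ('X - y%:P)
  else 0.

Lemma newton_quot0 rs : newton_quot rs 0 = (\prod_(y <- rs) ('X - y%:P))^`().
Proof.
elim: rs => [|z rs IH] /=; first by rewrite big_nil -polyC1 derivC.
by rewrite big_cons derivM derivXsubC IH mul1r expr0 scale1r addrC.
Qed.

(** In the summand of [z], the difference produces the factor X - z that its product lacks. *)
Lemma newton_quotS rs k : 'X * newton_quot rs k - newton_quot rs k.+1 =
  (\sum_(z <- rs) z ^+ k) *: \prod_(y <- rs) ('X - y%:P).
Proof.
elim: rs => [|z rs IH] /=; first by rewrite !big_nil mulr0 subr0 scale0r.
move: IH; rewrite !big_cons scalerDl -!mul_polyC exprS polyCM.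
set q := newton_quot rs k; set q' := newton_quot rs k.+1.
set P := \prod_(j <- rs) _; set S := (\sum_(j <- rs) _)%:P => IH.
rewrite (_ : S * (_ * P) = ('X - z%:P) * (S * P)); last by rewrite mulrCA.
by rewrite -IH; ring.
Qed.

Lemma size_newton_quot rs k : (size (newton_quot rs k) <= size rs)%N.
Proof.
elim: rs => [|z rs IH] /=; first by rewrite size_poly0.
apply: (leq_trans (size_polyD _ _)); rewrite geq_max; apply/andP; split.
  apply: (leq_trans (size_polyMleq _ _)); rewrite size_XsubC /=; exact: IH.
by apply: (leq_trans (size_scale_leq _ _)); rewrite size_prod_XsubC.
Qed.

Lemma intr_power_sum (p : {poly int}) rs k :
  map_poly intr p = \prod_(y <- rs) ('X - y%:P) ->
  exists s : int, \sum_(z <- rs) z ^+ k = s%:~R.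
Proof.
move=> prs.
(* Compare coefficients of degree [size rs] in [newton_quotS]: the next quotient has smaller degree
   and the full product is monic, so the power sum is a coefficient of an integral polynomial. *)
have step (Q : {poly int}) j : map_poly intr Q = newton_quot rs j ->
    \sum_(z <- rs) z ^+ j = (('X * Q)`_(size rs))%:~R.
  move=> QE; have /(congr1 (fun q : {poly F} => q`_(size rs))) := newton_quotS rs j.
  rewrite coefB coefZ [(newton_quot _ _)`_ _]nth_default ?size_newton_quot// subr0.
  have -> : (\prod_(y <- rs) ('X - y%:P))`_(size rs) = 1.
    have /monicP := monic_prod_XsubC rs xpredT id.
    by rewrite lead_coefE size_prod_XsubC.
  by rewrite mulr1 => <-; rewrite -QE -coef_map rmorphM /= map_polyX.
suff [Q /step ->] : exists Q : {poly int}, map_poly intr Q = newton_quot rs k.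
  by eexists.
elim: k => [|k [Q QE]]; first by exists p^`(); rewrite newton_quot0 -deriv_map prs.
(* This is [newton_quotS] solved for the next quotient, with the power sum replaced by its integral
   value. *)
exists ('X * Q - ('X * Q)`_(size rs) *: p).
rewrite rmorphB /= map_polyZ rmorphM /= map_polyX QE prs -(step _ _ QE).
by rewrite -newton_quotS opprB addrC subrK.
Qed.

End PowerSums.

(** In characteristic zero the derivative is nonzero of smaller degree, so an irreducible [p] cannot
    divide it and is coprime to it. *)
Lemma separable_irreducible (p : {poly rat}) :
  irreducible_poly p -> separable_poly p.
Proof.
move=> pirr; rewrite unlock irreducible_poly_coprime//.
have p0 : p != 0 by exact: irredp_neq0.
have pd := lt_size_deriv p0.
case: pirr => sp _.
rewrite gtNdvdp// -size_poly_gt0 polyorder.size_deriv.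
by case: (size p) sp => [|[|]].
Qed.

Lemma is_cvg_series_power_sum (R : realType) (s : seq R) :
  (forall x, x \in s -> `|x| < 1) ->
  cvgn (series (fun k => \sum_(x <- s) x ^+ k)).
Proof.
elim: s => [_|x s IH sx].
  rewrite (_ : series _ = cst 0); first exact: is_cvg_cst.
  by apply/funext => n; rewrite /series /=; apply: big1 => k _; rewrite big_nil.
rewrite (_ : (fun k => _) = (fun k => x ^+ k) + (fun k => \sum_(x <- s) x ^+ k)).
  rewrite seriesD; apply: is_cvgD; last first.
    by apply: IH => y ys; apply: sx; rewrite inE ys orbT.
  have := @is_cvg_geometric_series R 1 x; rewrite /geometric.
  under eq_fun do rewrite mul1r.
  by apply; apply: sx; rewrite inE eqxx.
by apply/funext => k; rewrite big_cons.
Qed.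

Lemma pisot_power_int (R : realType) (beta : R) (r : nat) : pisot beta r ->
  exists d : R ^nat, (forall k, exists m : int, beta ^+ k + d k = m%:~R) /\
    cvgn [normed series d].
Proof.
case=> beta_gt1 [p [pmon pirr psize proot pconj]].
pose pC : {poly R[i]} := map_poly intr p.
have [rs] := closed_field_poly_normal pC.
rewrite (monicP (monic_map _ pmon)) scale1r => pCE.
(* Simplicity of the roots matters: removing one copy of [beta] must leave only roots different from
   [beta], to which the modulus bound applies. *)
have urs : uniq rs.
  rewrite -separable_prod_XsubC -pCE.
  have -> : pC = map_poly (ratr : rat -> R[i]) (map_poly intr p).
    by rewrite -map_poly_comp; apply: eq_map_poly => m /=; rewrite ratr_int.
  by rewrite separable_map; exact: separable_irreducible.
have rootC z : root pC z = (z \in rs) by rewrite pCE root_prod_XsubC.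
have betars : (beta%:C)%C \in rs.
  rewrite -rootC (_ : pC = map_poly (real_complex R) (map_poly intr p)).
    by rewrite fmorph_root.
  rewrite -map_poly_comp; apply: eq_map_poly => m /=.
  by rewrite rmorph_int.
pose rs' := rem (beta%:C)%C rs.
have rs'1 z : z \in rs' -> `|z| < 1.
  rewrite mem_rem_uniq// inE => /andP[zb zrs].
  by apply: pconj => //; rewrite rootC.
(* The correction is the power sum of the other conjugates; the real part only serves to obtain a
   sequence in [R]. *)
exists (fun k => complex.Re (\sum_(z <- rs') z ^+ k)); split.
  move=> k; have [m mE] := intr_power_sum k pCE.
  exists m; move: mE; rewrite (perm_big _ (perm_to_rem betars))/= big_cons.
  move=> /(congr1 (@complex.Re R)); rewrite raddfD /=.
  by rewrite -rmorphXn /= -(rmorph_int (real_complex R)) /=.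
have normE (z : R[i]) : (complex.Re `|z|)%:C%C = `|z| by rewrite normc_def.
have Renorm_ge0 (z : R[i]) : 0 <= complex.Re `|z|.
  by rewrite -lecR normE; exact: normr_ge0.
apply: (series_le_cvg (v_ := fun k =>
  \sum_(x <- map (fun z : R[i] => complex.Re `|z|) rs') x ^+ k)).
- by move=> k; exact: normr_ge0.
- by move=> k; rewrite big_map; apply: sumr_ge0 => z _; exact: exprn_ge0.
- move=> k; rewrite big_map /= raddf_sum /=; apply: (le_trans (ler_norm_sum _ _ _)).
  apply: ler_sum => z _.
  by rewrite -lecR (le_trans (normc_ge_Re _))// rmorphXn /= normE normrX.
apply: is_cvg_series_power_sum => _ /mapP[z /rs'1 z1 ->].
by rewrite ger0_norm// -ltcR normE.
Qed.

(** * The maps phiplus and Phi *)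

Section Expansions.
Context (R : realType) (beta : R).
Hypothesis beta_gt1 : 1 < beta.

Let beta_gt0 : 0 < beta. Proof. exact: lt_trans beta_gt1. Qed.
Let beta_neq0 : beta != 0. Proof. exact: lt0r_neq0. Qed.

Lemma bounded_letters (A : seq int) :
  exists C : R, forall a, a \in A -> `|a%:~R : R| <= C.
Proof.
elim: A => [|a A [C CA]]; first by exists 0.
exists (Num.max `|a%:~R| C) => b; rewrite inE le_max.
by case/predU1P => [->|/CA->]; rewrite ?lexx ?orbT.
Qed.

Lemma cvgn_bounded_series (x : nat -> int) (C : R) (u : R^nat) :
  (forall i, `|(x i)%:~R : R| <= C) -> cvgn [normed series u] ->
  cvgn (series (fun k => (x k)%:~R * u k)).
Proof.
move=> xC cu; apply: normed_cvg.
apply: (series_le_cvg (v_ := fun k => C * `|u k|)).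
- by move=> k; exact: normr_ge0.
- by move=> k; apply: mulr_ge0 => //; exact: le_trans (xC 0%N).
- by move=> k /=; rewrite normrM ler_wpM2r.
rewrite (_ : series _ = (fun n => C * [normed series u] n)); last first.
  by apply/funext => n; rewrite /series/= mulr_sumr.
exact: is_cvgMl_tmp.
Qed.

Lemma cvgn_series_shift (u : R^nat) m :
  cvgn (series u) -> cvgn (series (fun k => u (m + k)%N)).
Proof.
elim: m u => // m IH u cu.
suff : cvgn (series (fun k => u k.+1)) by exact: IH.
rewrite (_ : series _ = (fun n => series u n.+1 - u 0%N)).
  apply: is_cvgB; last exact: is_cvg_cst.
  by move/cvg_ex : cu => [l]; rewrite -cvg_shiftS => /cvgP.
by apply/funext => n; rewrite !seriesEord /= big_ord_recl /= addrC addKr.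
Qed.

Lemma phiplus_cvg (x : SeqN) (C : R) : (forall i, `|(x i)%:~R : R| <= C) ->
  (fun N => \sum_(k < N) (x k)%:~R * beta ^- k.+1) @ \oo --> phiplus beta x.
Proof.
move=> xC; have : cvgn (series (fun k => (x k)%:~R * beta ^- k.+1)).
  apply: (cvgn_bounded_series xC).
  have geomE : [normed series (fun k => beta ^- k.+1)] =
      series (geometric beta^-1 beta^-1).
    apply/funext => n; rewrite /series/=; apply: eq_bigr => k _.
    by rewrite ger0_norm ?invr_ge0 ?exprn_ge0 ?ltW// -exprVn exprS.
  rewrite geomE; apply: is_cvg_geometric_series.
  by rewrite ger0_norm ?invr_ge0 ?ltW// invf_lt1.
by rewrite seriesEord.
Qed.

(** Multiplying by [beta] lowers every exponent by one, which frees the first digit and leaves the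
    series of the shorter tail. *)
Lemma phiplus_tailS n (y : SeqZ) (C : R) : (forall i, `|(y i)%:~R : R| <= C) ->
  beta * phiplus beta (tailN n.+1 y) =
  (y (- n.+1%:Z))%:~R + phiplus beta (tailN n y).
Proof.
move=> yC; have yCt k i : `|(tailN k y i)%:~R : R| <= C by exact: yC.
rewrite addrC.
have : (fun N => beta * \sum_(k < N.+1) (tailN n.+1 y k)%:~R * beta ^- k.+1) @ \oo -->
    beta * phiplus beta (tailN n.+1 y).
  apply: cvgMl_tmp; have := phiplus_cvg (yCt n.+1).
  by rewrite -cvg_shiftS.
have : (fun N => \sum_(k < N) (tailN n y k)%:~R * beta ^- k.+1 +
    (y (- n.+1%:Z))%:~R) @ \oo --> phiplus beta (tailN n y) + (y (- n.+1%:Z))%:~R.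
  by apply: cvgD; [exact: (phiplus_cvg (yCt n))|exact: cvg_cst].
rewrite (_ : (fun N => beta * _) =
    (fun N => \sum_(k < N) (tailN n y k)%:~R * beta ^- k.+1 +
    (y (- n.+1%:Z))%:~R)).
  by move=> h1 h2; exact: (cvg_unique _ h2 h1).
apply/funext => N; rewrite big_ord_recl /= mulrDr addrC; congr (_ + _).
  rewrite mulr_sumr; apply: eq_bigr => k _; rewrite mulrCA; congr (_%:~R * _).
    by rewrite /tailN; congr y; rewrite /bump /= add1n -(addn1 n) -(addn1 k) !PoszD; ring.
  by rewrite /bump /= add1n exprS invfM mulrA divff// mul1r.
by rewrite mulrCA expr1 divff// mulr1 /tailN sub0r.
Qed.

(** The [j]-th term has weight [beta] to the power m + n - j on the left and -(j + 1) in [phiplus],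
    whence the exponent [(m + n).+1]. *)
Lemma Phi_partialE m n (y : SeqZ) (C : R) : (forall i, `|(y i)%:~R : R| <= C) ->
  Phi_partial beta m y n = beta ^+ (m + n).+1 * phiplus beta (tailN n y).
Proof.
move=> yC; apply: cvg_lim => //.
have yCt i : `|(tailN n y i)%:~R : R| <= C by exact: yC.
have -> : (fun N => \sum_(j < N) (y (j%:Z - n%:Z))%:~R * beta ^ (m%:Z + n%:Z - j%:Z))
   = (fun N => beta ^+ (m + n).+1 * \sum_(k < N) (tailN n y k)%:~R * beta ^- k.+1).
  apply/funext => N; rewrite mulr_sumr; apply: eq_bigr => j _.
  rewrite mulrCA; congr (_ * _).
  rewrite -[beta ^+ _]/(beta ^ (m + n).+1) exprnN -expfzDr//; congr (_ ^ _).
  by rewrite -(addn1 (m + n)) -(addn1 j) !PoszD; ring.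
by apply: cvgMl_tmp; exact: phiplus_cvg yCt.
Qed.

(** This isolates the dependence on [n] in a finite sum of digits times positive powers of [beta],
    the part that converges only modulo 1. *)
Lemma Phi_partial_sum m n (y : SeqZ) (C : R) : (forall i, `|(y i)%:~R : R| <= C) ->
  Phi_partial beta m y n = beta ^+ m.+1 * phiplus beta (tailN 0 y) +
    \sum_(k < n) (y (- k.+1%:Z))%:~R * beta ^+ (m.+1 + k).
Proof.
move=> yC; rewrite (Phi_partialE _ _ yC); elim: n => [|n IH].
  by rewrite big_ord0 addr0 addn0.
rewrite big_ord_recr /= addrA -IH addnS exprSr -mulrA (phiplus_tailS _ yC).
by rewrite addSn mulrDr addrC (mulrC (_%:~R)).
Qed.

Variable r : nat.
Hypothesis pisot_beta : pisot beta r.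

Lemma tcvg_Phi_partial m (y : SeqZ) (C : R) : (forall i, `|(y i)%:~R : R| <= C) ->
  exists l, tcvg (Phi_partial beta m y) l.
Proof.
move=> yC; have [d [dint cd]] := pisot_power_int pisot_beta.
have [M ME] := choice dint.
have : cvgn (series (fun k => (y (- k.+1%:Z))%:~R * d (m.+1 + k)%N)).
  apply: (@cvgn_bounded_series (fun k => y (- k.+1%:Z)) C
    (fun k => d (m.+1 + k)%N)) => //.
  exact: (@cvgn_series_shift (fun k => `|d k|) m.+1 cd).
move/cvg_ex => [l dl].
exists (beta ^+ m.+1 * phiplus beta (tailN 0 y) - l); apply/tcvgP.
(* Each power of [beta] is an integer [M] minus [d]: the integers are discarded, and the digits
   against [d] form an absolutely convergent series with sum [l]. *)
exists (fun n => \sum_(k < n) y (- k.+1%:Z) * M (m.+1 + k)%N).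
rewrite (_ : (fun n => _) = (fun n => beta ^+ m.+1 * phiplus beta (tailN 0 y) -
    series (fun k => (y (- k.+1%:Z))%:~R * d (m.+1 + k)%N) n)).
  by apply: cvgB => //; exact: cvg_cst.
apply/funext => n; rewrite (Phi_partial_sum _ _ yC) -addrA; congr (_ + _).
rewrite seriesEord -sumrN rmorph_sum /= -sumrB; apply: eq_bigr => k _.
by rewrite rmorphM /= -ME; ring.
Qed.

Lemma tcvg_Phi (y : SeqZ) (C : R) (i : 'I_r) : (forall i, `|(y i)%:~R : R| <= C) ->
  tcvg (Phi_partial beta i y) (Phi beta r y i).
Proof. by move=> /(tcvg_Phi_partial i)[l]; exact: tlimP. Qed.

Lemma measurable_phiplus : measurable_fun setT (phiplus beta).
Proof.
apply: (@measurable_fun_limn _ SeqN R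
  (fun N x => \sum_(k < N) (x k)%:~R * beta ^- k.+1)) => N.
apply: measurable_sum => k; apply: measurable_funM => //.
exact: measurable_fun_letterN.
Qed.

Lemma measurable_Phi_partial m n :
  measurable_fun setT (fun y => Phi_partial beta m y n).
Proof.
apply: (@measurable_fun_limn _ SeqZ R (fun N x =>
  \sum_(j < N) (x (j%:Z - n%:Z))%:~R * beta ^ (m%:Z + n%:Z - j%:Z))) => N.
apply: measurable_sum => j; apply: measurable_funM => //.
exact: measurable_fun_letterZ.
Qed.

Lemma measurable_Phi : measurable_fun setT (Phi beta r : SeqZ -> Torus R r).
Proof.
apply: (@measurability _ _ SeqZ (Torus R r) setT _ (@torus_boxes R r)) => //.
move=> _ [_ [B [mB ->]] <-]; rewrite setTI.
rewrite (_ : _ @^-1` _ = \bigcap_(i in [set: 'I_r])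
    ((fun y => tlim (Phi_partial beta i y)) @^-1` B i)); last first.
  by apply/seteqP; split => y yB i; [move=> _|]; exact: yB.
apply: fin_bigcap_measurable => // i _; rewrite -[X in measurable X]setTI.
exact: (measurable_fun_tlim (measurable_Phi_partial i)).
Qed.

End Expansions.

Lemma measurable_torus_coord (R : realType) r (i : 'I_r) :
  measurable_fun setT (fun t : Torus R r => t i).
Proof.
move=> _ B mB; rewrite setTI; apply: sub_sigma_algebra.
exists (fun j => if j == i then B else setT); split.
  by move=> j; case: ifP.
apply/seteqP; split=> t tB => [j|]; first by case: eqP => // ->.
by have := tB i; rewrite eqxx.
Qed.

(** Summing over the appended letter produces the total matrix next to its right eigenvector [vR];
    the eigenvalue cancels the additional factor of [lam]. *)
Lemma cyl_weight_rcons (R : realType) (A : seq int) (n : nat) (E : rel 'I_n.+1)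
  (l : 'I_n.+1 -> 'I_n.+1 -> int) (lam : R) (vL vR : 'cV[R]_n.+1) w :
  0 < lam -> total_mx R A E l *m vR = lam *: vR ->
  cyl_weight E l lam vL vR w = \sum_(a <- A) cyl_weight E l lam vL vR (rcons w a).
Proof.
move=> lam0 MvR; rewrite /cyl_weight.
set P := \prod_(e <- w) label_mx R E l e.
rewrite [RHS](eq_bigr (fun a => lam ^- (size w).+1 *
    (vL^T *m P *m label_mx R E l a *m vR) ord0 ord0)); last first.
  by move=> a _; rewrite size_rcons -cats1 big_cat big_seq1 /= -mulmxE !mulmxA.
rewrite -mulr_sumr -summxE -mulmx_suml -mulmx_sumr -/(total_mx R A E l).
rewrite -(mulmxA _ (total_mx R A E l)) MvR -scalemxAr [in RHS]mxE.
rewrite exprSr invfM mulrA mulfVK//.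
exact: lt0r_neq0.
Qed.

(** * Convergence of the Fourier transform *)

Section Limit.
Context (R : realType) (A : seq int) (beta : R) (r : nat).
Variables (wt : seq int -> R) (mu_plus : probability SeqN R).
Variables (mu : probability SeqZ R) (mc : 'I_r -> int) (h : R -> R).
Hypothesis uniqA : uniq A.
Hypothesis wtS : forall w, all (mem A) w -> wt w = \sum_(a <- A) wt (rcons w a).
Hypothesis mu_plusA : forall w, all (mem A) w -> mu_plus (cylN w) = (wt w)%:E.
Hypothesis muA : forall m w, all (mem A) w -> mu (cylZ m w) = (wt w)%:E.
Hypothesis beta_pisot : pisot beta r.
Hypothesis h_continuous : continuous h.
Hypothesis h_periodic : forall x (m : int), h (x + m%:~R) = h x.
Hypothesis h_le1 : forall x, `|h x| <= 1.

Let z := \sum_(j < r) (mc j)%:~R * beta ^+ j.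

Let beta_gt1 : 1 < beta. Proof. by case: beta_pisot. Qed.

(** Bundles the pushforward with its measure structure, which rests on the measurability of
    [tailN n]. *)
Let tail_measure n : exists Q : {measure set SeqN -> \bar R},
  Q = pushforward mu (tailN n) :> (set SeqN -> \bar R).
Proof. by unshelve eexists (pushforward mu (tailN n)); first exact: measurable_tailN. Qed.

Let pushforward_tailA n w :
  all (mem A) w -> pushforward mu (tailN n) (cylN w) = (wt w)%:E.
Proof. by move=> wA; rewrite /pushforward preimage_tailN muA. Qed.

(** Stationarity: by [muA] the mass of [cylZ m w] does not depend on [m], so every tail has the
    cylinder weights of [mu_plus]. *)
Lemma pushforward_tailN n B :
  measurable B -> mu_plus B = pushforward mu (tailN n) B.
Proof.
have [Q QE] := tail_measure n; rewrite -QE.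
apply: (eq_measure_cylN uniqA wtS mu_plusA) => w.
by rewrite QE; exact: pushforward_tailA.
Qed.

Lemma ae_lettersZ : {ae mu, forall y : SeqZ, forall n i, tailN n y i \in A}.
Proof.
apply: ae_foralln => n; have [Q QE] := tail_measure n.
have : {ae Q, forall x, forall i, x i \in A}.
  apply: (ae_letters uniqA wtS) => w.
  by rewrite QE; exact: pushforward_tailA.
move=> [N [mN QN subN]]; exists (tailN n @^-1` N); split.
- by rewrite -[X in measurable X]setTI; exact: measurable_tailN.
- by rewrite -QN QE.
- by move=> y; exact: subN.
Qed.

Let letters_bounded (y : SeqZ) : (forall n i, tailN n y i \in A) ->
  exists C : R, forall i, `|(y i)%:~R : R| <= C.
Proof.
move=> yA; have [C CA] := bounded_letters R A; exists C => i; apply: CA.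
(* Nonnegative indices are read in [tailN 0]; the index -(p + 1) is the start of [tailN p.+1]. *)
case: i => p; first by have := yA 0%N p; rewrite /tailN subr0.
by have := yA p.+1 0%N; rewrite /tailN sub0r NegzE.
Qed.

Lemma integrable_h d (T : measurableType d) (P : probability T R) (f : T -> R) :
  measurable_fun setT f -> P.-integrable setT (fun x => (h (f x))%:E).
Proof.
move=> mf; apply: (@measurable_bounded_integrable _ _ _ _ (h \o f)) => //.
- exact: le_lt_trans (probability_le1 P measurableT) (ltry 1).
- by apply: measurableT_comp mf; exact: continuous_measurable_fun.
- exists 1; split; first exact: num_real.
  by move=> M M1 x _ /=; exact: le_trans (h_le1 _) (ltW M1).
Qed.

Let measurable_h d (T : measurableType d) (f : T -> R) :
  measurable_fun setT f -> measurable_fun setT (fun x => (h (f x))%:E).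
Proof.
move=> mf; apply/measurable_EFinP; apply: (measurableT_comp (f := h)) mf.
exact: continuous_measurable_fun.
Qed.

(** The tail length [n] is free, so it can be matched with the power of [beta] contained in [t]. *)
Let nu_integral n t :
  (\int[pushforward mu_plus (phiplus beta)]_x (h (x * t))%:E =
   \int[mu]_y (h (phiplus beta (tailN n y) * t))%:E)%E.
Proof.
have mphi := @measurable_phiplus R beta.
have mh : measurable_fun setT (fun x : R => (h (x * t))%:E).
  by apply: measurable_h; exact: measurable_funM.
have mphit : measurable_fun setT (fun x => phiplus beta x * t).
  exact: measurable_funM.
have mphih := measurable_h mphit.
rewrite (integral_pushforward mphi mh)//; last exact: integrable_h.
rewrite preimage_setT.
have [Q QE] := tail_measure n.
rewrite (eq_measure_integral Q); last first.
  by move=> B mB _; rewrite QE; exact: pushforward_tailN.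
rewrite QE integral_pushforward//.
- exact: measurable_tailN.
- rewrite preimage_setT.
  apply: (@integrable_h _ _ mu (fun y => phiplus beta (tailN n y) * t)).
  exact: (measurableT_comp (g := tailN n) mphit (measurable_tailN n)).
Qed.

Let measurable_sum_torus :
  measurable_fun setT (fun t : Torus R r => \sum_(j < r) (mc j)%:~R * t j).
Proof.
apply: measurable_sum => j; apply: measurable_funM => //.
exact: measurable_torus_coord.
Qed.

Let psi_integral :
  (\int[pushforward mu (Phi beta r)]_t (h (\sum_(j < r) (mc j)%:~R * t j))%:E =
   \int[mu]_y (h (\sum_(j < r) (mc j)%:~R * Phi beta r y j))%:E)%E.
Proof.
have mPhi := @measurable_Phi R beta r.
rewrite integral_pushforward//.
- exact: (measurable_h measurable_sum_torus).
- rewrite preimage_setT.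
  apply: (@integrable_h _ _ mu (fun y => \sum_(j < r) (mc j)%:~R * Phi beta r y j)).
  exact: (measurableT_comp (g := Phi beta r) measurable_sum_torus).
Qed.

Let h_cvg (y : SeqZ) : (forall n i, tailN n y i \in A) ->
  (fun n => h (phiplus beta (tailN n y) * (z * beta ^+ n.+1))) @ \oo -->
  h (\sum_(j < r) (mc j)%:~R * Phi beta r y j).
Proof.
move=> /letters_bounded[C yC].
have [m mE] := choice (fun j : 'I_r =>
  (tcvgP _ _).1 (tcvg_Phi beta_gt1 beta_pisot j yC)).
rewrite (_ : (fun n => _) = (fun n => h (\sum_(j < r) (mc j)%:~R *
    (Phi_partial beta j y n - (m j n)%:~R)))).
  apply: continuous_cvg; first exact: h_continuous.
  apply: cvg_big => [|j _]; first exact: add_continuous.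
  by apply: cvgMl_tmp; exact: mE.
(* As the [mc j] are integers, the corrections [m j n] add up to an integer, which periodicity
   absorbs. *)
apply/funext => n; rewrite -(h_periodic (\sum_(j < r) _) (\sum_(j < r) mc j * m j n)).
congr h; rewrite rmorph_sum /= -big_split /= mulrC mulr_suml mulr_suml.
apply: eq_bigr => j _; rewrite (Phi_partialE beta_gt1 _ _ yC) rmorphM /=.
by rewrite -addnS exprD; ring.
Qed.

(** The function [h] stands for both the cosine and the sine of 2 pi x, so that real and imaginary
    parts share one argument. *)
Lemma cvg_Fourier :
  (fun k => fine (\int[pushforward mu_plus (phiplus beta)]_x
     (h (x * (z * beta ^+ k)))%:E)%E) @ \oo -->
  fine (\int[pushforward mu (Phi beta r)]_t
     (h (\sum_(j < r) (mc j)%:~R * t j))%:E)%E.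
Proof.
(* Dropping the term of index 0 pairs [beta ^+ k.+1] with [tailN k], as [h_cvg] requires. *)
rewrite -cvg_shiftS psi_integral.
rewrite (funext (fun k => congr1 fine (nu_integral k (z * beta ^+ k.+1)))).
have mf n : measurable_fun setT
    (fun y => phiplus beta (tailN n y) * (z * beta ^+ n.+1)).
  apply: measurable_funM => //.
  exact: (measurableT_comp (g := tailN n) (@measurable_phiplus R beta)
    (measurable_tailN n)).
have mg : measurable_fun setT
    (fun y : SeqZ => \sum_(j < r) (mc j)%:~R * Phi beta r y j).
  exact: (measurableT_comp (g := Phi beta r) measurable_sum_torus
    (@measurable_Phi R beta r)).
have [] := @dominated_convergence _ _ _ mu setT measurableT
  (fun n y => (h (phiplus beta (tailN n y) * (z * beta ^+ n.+1)))%:E)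
  (fun y => (h (\sum_(j < r) (mc j)%:~R * Phi beta r y j))%:E) (cst 1%E).
- by move=> n; exact: (measurable_h (mf n)).
- exact: (measurable_h mg).
(* Pointwise convergence is obtained only almost everywhere, where all letters lie in [A] and are
   therefore bounded. *)
- apply: filterS ae_lettersZ => y yA _; apply: cvg_EFin; first exact: nearW.
  exact: h_cvg.
- exact: finite_measure_integrable_cst.
- by apply: nearW => y n _; rewrite lee_fin.
move=> hint _ hcvg; apply: fine_cvg.
by rewrite fineK ?(integrable_fin_num measurableT hint).
Qed.

End Limit.

Lemma periodic_2piz (R : realType) (f : R -> R) (x : R) (m : int) :
  periodic f (pi *+ 2) -> f (2 * pi * (x + m%:~R)) = f (2 * pi * x).
Proof.
move=> fper; have pE (p : nat) : 2 * pi * p%:R = (pi *+ 2) *+ p :> R.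
  by rewrite mulr_natr mulr_natl.
case: m => p; first by rewrite mulrDr -pmulrn pE periodicn.
rewrite NegzE rmorphN /= mulrDr mulrN -pmulrn pE.
(* A negative shift is undone by adding the same number of periods to the shifted point. *)
by rewrite -[LHS](periodicn fper p.+1) subrK.
Qed.

Theorem theorem12 (R : realType)
  (A : seq int) (n : nat) (E : rel 'I_n.+1) (l : 'I_n.+1 -> 'I_n.+1 -> int)
  (lam : R) (vL vR : 'cV[R]_n.+1)
  (beta : R) (r : nat)
  (mu_plus : probability SeqN R) (mu : probability SeqZ R)
  (mc : 'I_r -> int) :
  uniq A ->
  (forall i j, E i j -> l i j \in A) ->
  primitive_mx (total_mx R A E l) ->
  0 < lam ->
  (forall i, 0 < vL i ord0) -> (forall i, 0 < vR i ord0) ->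
  vL^T *m total_mx R A E l = lam *: vL^T ->
  total_mx R A E l *m vR = lam *: vR ->
  (vL^T *m vR) ord0 ord0 = 1 ->
  pisot beta r ->
  (forall w : seq int, all (mem A) w ->
     mu_plus (cylN w) = (cyl_weight E l lam vL vR w)%:E) ->
  (forall (m : int) (w : seq int), all (mem A) w ->
     mu (cylZ m w) = (cyl_weight E l lam vL vR w)%:E) ->
  let z := \sum_(j < r) (mc j)%:~R * beta ^+ j in
  let nu := pushforward mu_plus (phiplus beta) in
  let psi := pushforward mu (Phi beta r) in
  (fun k : nat => ft_re nu (z * beta ^+ k)) @ \oo --> fc_re psi mc /\
  (fun k : nat => ft_im nu (z * beta ^+ k)) @ \oo --> fc_im psi mc.
Proof.
move=> uniqA _ _ lam0 _ _ _ MvR _ beta_pisot mu_plusA muA z nu psi.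
have wtS w (_ : all (mem A) w) := cyl_weight_rcons vL w lam0 MvR.
have limit h := @cvg_Fourier R A beta r _ mu_plus mu mc h
  uniqA wtS mu_plusA muA beta_pisot.
have cont2pi : continuous (fun x : R => 2 * pi * x).
  by move=> x; apply: cvgMl_tmp; exact: cvg_id.
have ft_reE t : ft_re nu t = fine (\int[nu]_x (cos (2 * pi * (x * t)))%:E)%E.
  by rewrite /ft_re; congr (fine (integral _ _ _)); apply/funext => x; rewrite mulrA.
have ft_imE t : ft_im nu t = - fine (\int[nu]_x (sin (2 * pi * (x * t)))%:E)%E.
  by rewrite /ft_im; congr (- fine (integral _ _ _)); apply/funext => x; rewrite mulrA.
split.
- rewrite (funext (fun k => ft_reE (z * beta ^+ k))).
  apply: (limit (fun x => cos (2 * pi * x))).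
  + by move=> x; apply: continuous_comp; [exact: cont2pi|exact: continuous_cos].
  + by move=> x m; rewrite periodic_2piz//; exact: cosD2pi.
  + by move=> x; rewrite ler_norml cos_geN1 cos_le1.
- rewrite (funext (fun k => ft_imE (z * beta ^+ k))); apply: cvgN.
  apply: (limit (fun x => sin (2 * pi * x))).
  + by move=> x; apply: continuous_comp; [exact: cont2pi|exact: continuous_sin].
  + by move=> x m; rewrite periodic_2piz//; exact: sinD2pi.
  + by move=> x; rewrite ler_norml sin_geN1 sin_le1.
Qed.
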